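(* Let $n$ be a positive integer all of whose components are congruent to $1$ modulo $4$. Then there exists a $(G_1\times V_n,G_1\times\{0\},3,1)$ difference family which is $J$-resolvable for $J=\{0,(0,1,1,0)\}$ and which admits a group of strong multipliers whose order is the greatest odd divisor of $\psi(n)$.
   Context: A component of an integer is a maximal prime power dividing it. For $N$ with components $q_1,\dots,q_\omega$, $\mathbb F_N=\mathbb F_{q_1}\times\dots\times\mathbb F_{q_\omega}$, $V_N$ is its additive group ($V_1$ trivial), and $\psi(N)=\prod_i(q_i-1)$. $G_1$ is the group on $\mathbb Z_3\times\mathbb Z_2\times\mathbb Z_2$ with $(a,b,c)+(d,e,f)=(a,b,c)\Theta^d+(d,e,f)$, $\Theta$ the matrix with rows $(1,0,0),(0,0,1),(0,-1,-1)$ acting on row vectors ($G_1\cong A_4$); $(0,1,1,0)$ is the canonical involution of $G_1\times V_n$. Groups are written additively, $x-y:=x+(-y)$. For $H\le G$, a $(G,H,3,1)$ difference family is a family $\mathcal F$ of $3$-subsets of $G$ whose multiset of differences $x-y$ (over ordered pairs of distinct elements in a common block) equals $G\setminus H$ (each element once); for $J\le H$ of order $2$ it is $J$-resolvable if the multiset union of its blocks is a complete system of representatives for the left cosets of $J$ not contained in $H$. A strong multiplier is an automorphism of $G$ fixing $H$ elementwise and mapping the set of blocks onto itself. *)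

(* Defs.v *)
From HB Require Import structures.
From mathcomp Require Import all_boot all_order all_algebra.
From mathcomp Require Import all_fingroup all_solvable all_field.
From mathcomp Require Import ring.
Set Implicit Arguments.
Unset Strict Implicit.
Unset Printing Implicit Defensive.
Import GRing.Theory.

Definition components (N : nat) : seq nat := [seq p ^ logn p N | p <- primes N].

Definition psi (N : nat) : nat := \prod_(q <- components N) q.-1.

Definition greatest_odd_divisor (m : nat) : nat :=
  \max_(d <- divisors m | odd d) d.

Lemma component_field_exists (N : nat) (i : 'I_(size (components N))) :
  {F : finFieldType | #|F| = nth 0 (components N) i}.
Proof.
have ltiN: i < size (primes N).
  by apply: leq_trans (ltn_ord i) _; rewrite size_map.
have pP: nth 0 (primes N) i \in primes N by apply: mem_nth.
have pr: prime (nth 0 (primes N) i) by move: pP; rewrite mem_primes => /andP[].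
have k0: 0 < logn (nth 0 (primes N) i) N by rewrite logn_gt0.
have [F _ cardF] := pPrimePowerField pr k0.
by exists F; rewrite (nth_map 0) // cardF.
Qed.

Definition component_field (N : nat) (i : 'I_(size (components N))) :
  finFieldType := sval (component_field_exists i).

(* [FinRing.Field_to_finGroup F] is the additive group of F, so the group operation
   [*%g] of [V N] is componentwise field addition and [1%g] is the zero of
   F_N. *)
Definition V (N : nat) : finGroupType :=
  {dffun forall i : 'I_(size (components N)),
     FinRing.Field_to_finGroup (component_field i)}.

Definition G1 : Type := 'Z_3 * 'Z_2 * 'Z_2.
HB.instance Definition _ := Finite.on G1.

(* Row vector (a, b, c) times the matrix with rows
   (1,0,0), (0,0,1), (0,-1,-1). *)
Definition G1_Theta (x : G1) : G1 :=
  let: (a, b, c) := x in (a, - c, b - c)%R.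

(* [x Theta^d + y] with d the first coordinate of y; the outer sum is the
   coordinatewise one of Z_3 x Z_2 x Z_2. *)
Definition G1_add (x y : G1) : G1 :=
  let: (a, b, c) := iter (y.1.1 : nat) G1_Theta x in
  let: (d, e, f) := y in (a + d, b + e, c + f)%R.

Definition G1_zero : G1 := (0, 0, 0)%R.

Definition G1_opp (x : G1) : G1 :=
  let: (a, b, c) := iter (- x.1.1 : 'Z_3)%R G1_Theta x in (- a, - b, - c)%R.

Lemma G1_addA : associative G1_add.
Proof.
move=> [[a b] c] [[[d ltd] e] f] [[[g ltg] h] k].
rewrite /G1_add.
case: d ltd => [|[|[|//]]] ltd; case: g ltg => [|[|[|//]]] ltg /=;
  by congr (_, _, _); rewrite ?addrA //; ring.
Qed.

Lemma G1_add0 : left_id G1_zero G1_add.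
Proof.
move=> [[[d ltd] e] f]; rewrite /G1_add.
by case: d ltd => [|[|[|//]]] ltd /=; congr (_, _, _); ring.
Qed.

Lemma G1_addN : left_inverse G1_zero G1_opp G1_add.
Proof.
move=> [[[d ltd] e] f]; rewrite /G1_add /G1_opp /G1_zero.
by case: d ltd => [|[|[|//]]] ltd /=; congr (_, _, _); ring.
Qed.

HB.instance Definition _ := Finite_isGroup.Build G1 G1_addA G1_add0 G1_addN.

Section DifferenceFamilies.
Local Open Scope group_scope.

Variable gT : finGroupType.
Implicit Types (F : seq {set gT}) (H J : {group gT}) (B : {set gT}).

(* Families are lists, i.e. multisets, of blocks of the (multiplicatively
   written) group; the additive x - y is x * y^-1. *)
Definition differences F : seq gT :=
  flatten [seq [seq z.1 * z.2^-1 | z <- enum (setX B B) & z.1 != z.2]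
          | B : {set gT} <- F].

Definition difference_family H F : Prop :=
  {in F, forall B, #|B| = 3} /\ perm_eq (differences F) (enum (~: H)).

(* The blocks, listed with multiplicity, meet each left coset of J not
   contained in H exactly once, and meet no other coset. *)
Definition resolvable H J F : Prop :=
  [/\ J \subset H, #|J| = 2 &
      perm_eq [seq x *: J | x <- flatten [seq enum B | B : {set gT} <- F]]
              (enum [set C in lcosets J [set: gT] | ~~ (C \subset H)])].

Definition strong_multiplier H F (a : {perm gT}) : Prop :=
  [/\ a \in Aut [set: gT], {in H, forall x, a x = x} &
      [set a @: B | B : {set gT} in F] = [set B in F]].

End DifferenceFamilies.

Definition canonical_involution (n : nat) : G1 * V n :=
  (((0, 1, 1)%R : G1), 1%g).

Lemma canonical_J_group_set (n : nat) :
  group_set [set 1%g; canonical_involution n].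
Proof.
apply/group_setP; split=> [|x y]; first by rewrite !inE eqxx.
rewrite !inE => /orP[]/eqP-> /orP[]/eqP->; rewrite ?mul1g ?mulg1 ?eqxx ?orbT //.
apply/orP; left; apply/eqP; congr (_, _); last exact: mul1g.
by apply/eqP.
Qed.

Definition canonical_J (n : nat) : {group G1 * V n} :=
  Group (canonical_J_group_set n).

Definition G1_sub (n : nat) : {group G1 * V n} :=
  [group of setX [set: G1] [set 1%g : V n]].

(* Main.v *)
Require Import Defs.
From mathcomp Require Import all_boot all_order all_algebra.
From mathcomp Require Import all_fingroup all_solvable all_field.

(** Multiplication by a componentwise square root of -1 is an automorphism [i]
    of [V_n] with [i^2 = -1], acting freely on the nonzero elements.  Let [A] be
    the odd part of the unit group of [F_n].  Since [A] has odd order and commutes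
    with [i], there is an [A]-invariant set [S] of representatives for the
    [<i>]-orbits of nonzero elements.  Eight triples with entries in
    [G_1 x {1, i, -1, -i}] are developed by multiplying the second coordinate by
    the elements of [S].  Up to powers of [i], the difference of two distinct
    powers of [i] is [1 - i] or [(1 - i)^2], both invertible; the eight triples are
    such that for each [g] in [G_1] the four differences over [g] are
    [(1 - i)^t <i>] with [t] depending only on [g], and that over each left coset
    of [J] in [G_1] the four points are [<i>].  Both facts are a finite computation
    in [G_1], independent of [n]. *)

Set Implicit Arguments.
Unset Strict Implicit.
Unset Printing Implicit Defensive.

Import GRing.Theory.

(** * Lists up to permutation, and the odd part of an integer *)

Lemma flatten_map_allpairs (I K T Y : Type) (D : T -> seq Y) (g : I -> K -> T)
    (s : seq I) (t : seq K) :
  flatten [seq D x | x <- [seq g i k | i <- s, k <- t]]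
    = flatten [seq flatten [seq D (g i k) | k <- t] | i <- s].
Proof.
by elim: s => //= i s <-; rewrite map_cat flatten_cat -map_comp.
Qed.

Lemma perm_flatten_map (I Y : eqType) (D E : I -> seq Y) (s : seq I) :
  {in s, forall i, perm_eq (D i) (E i)} ->
  perm_eq (flatten [seq D i | i <- s]) (flatten [seq E i | i <- s]).
Proof.
elim: s => //= i s IHs DE; apply: perm_cat; first by rewrite DE ?mem_head.
by apply: IHs => j sj; rewrite DE // inE sj orbT.
Qed.

Lemma perm_enum_seq (T : finType) (s : seq T) :
  uniq s -> perm_eq (enum [set x in s]) s.
Proof.
by move=> Us; apply: uniq_perm => // [|x]; rewrite ?enum_uniq // mem_enum inE.
Qed.

(** The part of [m] prime to 2 is the form in which the order of a Hall subgroup of the unit group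
    appears. *)
Lemma greatest_odd_divisorE (m : nat) : 0 < m -> greatest_odd_divisor m = m`_2^'.
Proof.
move=> m_gt0; apply/eqP; rewrite eqn_leq; apply/andP; split.
  apply/bigmax_leqP_seq => d; rewrite -dvdn_divisors // => dm d_odd.
  apply: dvdn_leq; first exact: part_gt0.
  rewrite -[d](@part_pnat_id 2^'); first exact: partn_dvd.
  by rewrite -odd_2'nat.
apply: leq_bigmax_seq; first by rewrite -dvdn_divisors ?dvdn_part.
by rewrite odd_2'nat part_pnat.
Qed.

(** * Base blocks and the finite computation in [G1] *)

Local Open Scope group_scope.

(* With [i] for the quarter turn and [m := 1 - i] one has
   [i^a - i^(a+1) = i^a m], [i^a - i^(a+2) = i^(a+1) m^2] and
   [i^a - i^(a+3) = i^(a+1) m]; the value is the pair of the exponents of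
   [m] and of [i]. *)
Definition gauss_diff (a b : nat) : nat * nat :=
  nth (0, 0)%N [:: (0, 0); (1, a); (2, a.+1 %% 4); (1, a.+1 %% 4)]%N
    ((b + 4 - a) %% 4).

Definition g1 (a b c : nat) : G1 := (inZp a, inZp b, inZp c).

(* The pair [(g, e)] stands for the point [(g, i^e)]; the blocks come from a
   computer search. *)
Definition base_blocks : seq (seq (G1 * nat)) :=
  [:: [:: (g1 0 0 0, 1); (g1 1 0 0, 2); (g1 0 0 0, 3)];
      [:: (g1 1 0 0, 0); (g1 1 0 1, 2); (g1 0 1 0, 3)];
      [:: (g1 2 0 1, 0); (g1 0 1 0, 1); (g1 2 0 0, 2)];
      [:: (g1 1 0 1, 0); (g1 2 1 0, 1); (g1 2 0 0, 3)];
      [:: (g1 2 0 0, 0); (g1 1 0 0, 1); (g1 2 1 0, 2)];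
      [:: (g1 0 0 0, 0); (g1 0 0 0, 2); (g1 1 0 1, 3)];
      [:: (g1 0 0 1, 0); (g1 2 0 0, 1); (g1 2 0 1, 3)];
      [:: (g1 1 0 1, 1); (g1 0 1 0, 2); (g1 1 0 0, 3)]]%N.

(** The entry [(g, (t, e))] stands for the difference (g, i^e (1 - i)^t). *)
Definition base_differences (b : seq (G1 * nat)) : seq (G1 * (nat * nat)) :=
  [seq (z.1.1 * z.2.1^-1, gauss_diff z.1.2 z.2.2)
     | z <- [seq (x, y) | x <- b, y <- b] & z.1 != z.2].

(** Written out explicitly so that the tables built on it evaluate under [vm_compute]. *)
Definition G1_list : seq G1 :=
  [seq g1 a.1 a.2 c | a <- [seq (a, b) | a <- iota 0 3, b <- iota 0 2],
                      c <- iota 0 2].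

Definition G1_involution : G1 := g1 0 1 1.

(* The element of [{g, g + (0, 1, 1)}] whose second coordinate vanishes. *)
Definition coset_rep (g : G1) : G1 := (g.1.1, 0%R, (g.1.2 + g.2)%R).

(** In a base block two exponents differ by 2 exactly when the entries agree in the Z_3 coordinate,
    so the power of 1 - i in a difference can be read off its first coordinate. *)
Definition diff_level (g : G1) : nat := (if g.1.1 == 0%R then 2 else 1)%N.

Lemma mem_G1_list g : g \in G1_list.
Proof.
case: g => [[[a a3] [b b2]] [c c2]].
by case: a a3 => [|[|[|//]]] a3;
  case: b b2 => [|[|//]] b2; case: c c2 => [|[|//]] c2.
Qed.

(** Distinct exponents inside a block keep every difference off [G1] x {0}, and keep [gauss_diff]
    away from its placeholder value at equal exponents. *)
Lemma base_blocks_wf : all (fun b =>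
  [&& size b == 3, uniq (unzip2 b) & all (fun x => x.2 < 4) b]) base_blocks.
Proof. by []. Qed.

Definition difference_table : seq (G1 * (nat * nat)) :=
  [seq (g, (diff_level g, e)) | g <- G1_list, e <- iota 0 4].

Definition point_table : seq (G1 * nat) :=
  [seq (g, e) | g <- [seq g <- G1_list | coset_rep g == g], e <- iota 0 4].

Lemma mem_difference_table w :
  (w \in difference_table) = (w.2.1 == diff_level w.1) && (w.2.2 < 4).
Proof.
apply/allpairsP/andP => [[[g e] [_ + ->]]|[/eqP wE w4]].
  by rewrite mem_iota.
exists (w.1, w.2.2); rewrite mem_G1_list mem_iota -wE; split=> //.
by case: w {wE w4} => ? [].
Qed.

Lemma mem_point_table x :
  (x \in point_table) = (coset_rep x.1 == x.1) && (x.2 < 4).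
Proof.
apply/allpairsP/andP => [[[g e] []]|[xE x4]].
  by rewrite mem_filter mem_iota => /andP[? _] ? ->.
by exists x; rewrite mem_filter xE mem_G1_list mem_iota -surjective_pairing.
Qed.

Lemma difference_table_uniq : uniq difference_table.
Proof. by vm_compute. Qed.

Lemma point_table_uniq : uniq point_table.
Proof. by vm_compute. Qed.

(** Eight blocks with six differences each fill the 12 * 4 entries of the table. *)
Lemma perm_base_differences :
  perm_eq (flatten [seq base_differences b | b <- base_blocks])
          difference_table.
Proof. by vm_compute. Qed.

(** The 24 points fill six cosets times four exponents. *)
Lemma perm_base_points :
  perm_eq (flatten [seq [seq (coset_rep x.1, x.2) | x <- b] | b <- base_blocks])
          point_table.
Proof. by vm_compute. Qed.

Lemma coset_repP g : (coset_rep g == g) || (coset_rep g == g * G1_involution).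
Proof.
have: all (fun g => (coset_rep g == g) || (coset_rep g == g * G1_involution)) G1_list.
  by vm_compute.
by move/allP; apply; apply: mem_G1_list.
Qed.

Lemma coset_rep_idem g : coset_rep (coset_rep g) = coset_rep g.
Proof. by rewrite /coset_rep /= add0r. Qed.

Lemma coset_rep_invol g : coset_rep (g * G1_involution) = coset_rep g.
Proof.
have: all (fun g => coset_rep (g * G1_involution) == coset_rep g) G1_list.
  by vm_compute.
by move/allP=> all_g; apply/eqP/all_g/mem_G1_list.
Qed.

(** * A quarter turn on an abelian group without involutions *)

Section QuarterTurn.

Variables (vT : finGroupType) (f : vT -> vT).
Hypotheses (vTC : commutative (@mulg vT)) (fM : {morph f : x y / x * y}).
Hypotheses (ff : forall x, f (f x) = x^-1).
Hypothesis sq_eq1 : forall x : vT, x * x = 1 -> x = 1.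

Let f1 : f 1 = 1.
Proof. by apply: (mulgI (f 1)); rewrite -fM !mulg1. Qed.

Let fV x : f x^-1 = (f x)^-1.
Proof. by apply: (mulgI (f x)); rewrite -fM !mulgV. Qed.

Let f4 x : iter 4 f x = x.
Proof. by rewrite /= !ff invgK. Qed.

Let f_inj : injective f.
Proof. by move=> x y eqf; rewrite -[x]f4 -[y]f4 /= eqf. Qed.

Lemma iter_quarter_mod e x : iter (e %% 4) f x = iter e f x.
Proof.
rewrite {2}(divn_eq e 4) addnC iterD; congr (iter _ f _).
by elim: (e %/ 4) => // k IHk; rewrite mulSn iterD -IHk f4.
Qed.

(** A fixed point of [f] equals its own inverse, and there is no 2-torsion. *)
Lemma quarter_eq1 x : f x = x -> x = 1.
Proof. by move=> fx; apply: sq_eq1; have := ff x; rewrite !fx => {2}->; rewrite mulgV.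
Qed.

(** Modulo 4, an exponent 1 or 3 would give a fixed point of [f], and an exponent 2 would give x =
    x^-1. *)
Lemma quarter_free e x : x != 1 -> iter e f x = x -> 4 %| e.
Proof.
move=> x_neq1; rewrite -iter_quarter_mod /dvdn.
case: (e %% 4) (ltn_pmod e (isT : 0 < 4)) => [|[|[|[|//]]]] //= _ fx.
- by case/eqP: x_neq1; apply: quarter_eq1.
- by case/eqP: x_neq1; apply: sq_eq1; rewrite -{2}fx ff mulgV.
by case/eqP: x_neq1; apply: quarter_eq1; have := f4 x; rewrite /= fx.
Qed.

Definition one_minus (x : vT) := x * (f x)^-1.

Let mulgACA (x y z t : vT) : x * y * (z * t) = x * z * (y * t).
Proof. by rewrite -!mulgA; congr (_ * _); rewrite !mulgA (vTC y z). Qed.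

(** The kernel of the endomorphism 1 - i consists of the fixed points of i. *)
Lemma one_minus_inj : injective one_minus.
Proof.
move=> x y eqxy; apply/eqP; rewrite eq_mulgV1; apply/eqP/quarter_eq1.
apply/eqP; rewrite eq_sym eq_mulgV1 fM fV invMg invgK (vTC (f y)) mulgACA.
move: eqxy; rewrite /one_minus => ->.
by rewrite mulgACA mulgV mulVg mulg1.
Qed.

Lemma one_minus_iter e x : one_minus (iter e f x) = iter e f (one_minus x).
Proof.
by elim: e => //= e <-; rewrite /one_minus /= fM fV.
Qed.

Lemma iter_one_minus_quarter t e x :
  iter t one_minus (iter e f x) = iter e f (iter t one_minus x).
Proof. by elim: t => //= t ->; rewrite one_minus_iter. Qed.

Lemma iter_one_minus_inj t : injective (iter t one_minus).
Proof. by elim: t => // t IHt x y /= /one_minus_inj/IHt. Qed.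

Lemma iter_one_minus1 t : iter t one_minus 1 = 1.
Proof. by elim: t => //= t ->; rewrite /one_minus f1 invg1 mulg1. Qed.

Lemma iter_quarter1 e : iter e f 1 = 1.
Proof. by elim: e => //= e ->. Qed.

Lemma iter_quarter_inj e : injective (iter e f).
Proof. by elim: e => // e IHe x y /= /f_inj/IHe. Qed.

(** These are the identities encoded in [gauss_diff]; for exponents differing by 2 the identity is 2
    = i (1 - i)^2. *)
Lemma quarter_diff a b x : a < 4 -> b < 4 -> a != b ->
  iter a f x * (iter b f x)^-1 =
    iter (gauss_diff a b).2 f (iter (gauss_diff a b).1 one_minus x).
Proof.
rewrite /gauss_diff.
case: a => [|[|[|[|//]]]]; case: b => [|[|[|[|//]]]] //= _ _ _;
  rewrite /one_minus ?(ff, fM, fV, invMg, invgK).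
all: by first [done | by rewrite vTC | rewrite mulgACA mulgV ?mul1g ?mulg1].
Qed.

(** * An invariant transversal for a commuting group of odd order *)

Variable A : {group {perm vT}}.
Hypothesis oddA : odd #|A|.
Hypothesis AM : {in A, forall a : {perm vT}, {morph a : x y / x * y}}.
Hypothesis Af : {in A, forall a : {perm vT}, forall x, a (f x) = f (a x)}.

Let A1 a : a \in A -> a 1 = 1.
Proof. by move=> Aa; apply: (mulgI (a 1)); rewrite -AM // !mulg1. Qed.

Let A_iter a e x : a \in A -> a (iter e f x) = iter e f (a x).
Proof. by move=> Aa; elim: e => //= e <-; rewrite Af. Qed.

(** The orbit under the group generated by [A] and [f]; the bound 4 on the exponent makes membership
    a finite test. *)
Definition quarter_orbit (x : vT) : {set vT} :=
  [set y | [exists a in A, [exists e : 'I_4, y == iter e f (a x)]]].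

Lemma quarter_orbitP x y :
  reflect (exists2 a, a \in A & exists e, y = iter e f (a x))
          (y \in quarter_orbit x).
Proof.
rewrite inE; apply: (iffP exists_inP) => [[a Aa /existsP[e /eqP->]]|[a Aa [e ->]]].
  by exists a => //; exists e.
exists a => //; apply/existsP; exists (Ordinal (ltn_pmod e (isT : 0 < 4))) => /=.
by rewrite iter_quarter_mod.
Qed.

Lemma quarter_orbit_sym x y : y \in quarter_orbit x -> x \in quarter_orbit y.
Proof.
case/quarter_orbitP=> a Aa [e ->]; apply/quarter_orbitP.
(* Since 3 = -1 modulo 4, 3e further turns undo e turns. *)
exists a^-1; rewrite ?groupV //; exists (e * 3)%N.
rewrite A_iter ?groupV // permK -iterD -mulnSr -iter_quarter_mod.
by rewrite mulnC modnMr.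
Qed.

Lemma quarter_orbit_trans x y z :
  y \in quarter_orbit x -> z \in quarter_orbit y -> z \in quarter_orbit x.
Proof.
case/quarter_orbitP=> a Aa [e ->] /quarter_orbitP[b Ab [k ->]].
apply/quarter_orbitP; exists (a * b); rewrite ?groupM //; exists (k + e)%N.
by rewrite A_iter // iterD permM.
Qed.

Lemma quarter_orbit_eq x y :
  y \in quarter_orbit x -> quarter_orbit y = quarter_orbit x.
Proof.
move=> xy; apply/setP => z; apply/idP/idP; first exact: quarter_orbit_trans xy.
exact/quarter_orbit_trans/quarter_orbit_sym.
Qed.

Lemma mem_repr_quarter_orbit x : repr (quarter_orbit x) \in quarter_orbit x.
Proof.
by apply: (@mem_repr _ _ x); apply/quarter_orbitP; exists 1 => //;
  exists 0; rewrite perm1.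
Qed.

(* The odd order of [a] makes the exponent of the quarter turn vanish. *)
Lemma quarter_orbit_free a e x :
  a \in A -> x != 1 -> iter e f (a x) = x -> 4 %| e.
Proof.
move=> Aa x_neq1 ax.
have iter_ax k : iter (k * e) f ((a ^+ k) x) = x.
  elim: k => [|k IHk]; first by rewrite perm1.
  rewrite expgS permM mulSnr iterD.
  by rewrite -(A_iter e (a x)) ?groupX // ax.
have := iter_ax #|A|; rewrite expg_cardG // perm1 => /(quarter_free x_neq1).
by rewrite Gauss_dvdr // (@coprimeXl 2 2) // coprime2n.
Qed.

(** In each orbit of [A] and [f] together, only the [A]-orbit of one chosen element is kept. This
    gives [A]-invariance at once; freeness then leaves one element in each orbit of [f]. *)
Definition transversal_set : {set vT} :=
  [set x | (x != 1) && [exists a in A, x == a (repr (quarter_orbit x))]].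

Lemma transversal_neq1 x : x \in transversal_set -> x != 1.
Proof. by rewrite inE => /andP[]. Qed.

Lemma transversal_perm a x :
  a \in A -> x \in transversal_set -> a x \in transversal_set.
Proof.
move=> Aa; rewrite !inE => /andP[x_neq1 /exists_inP[b Ab /eqP xE]].
rewrite -(A1 Aa) (inj_eq perm_inj) x_neq1 /=.
apply/exists_inP; exists (b * a); rewrite ?groupM // permM.
rewrite (@quarter_orbit_eq x) -?xE //.
by apply/quarter_orbitP; exists a => //; exists 0.
Qed.

Lemma transversal_exists x : x != 1 ->
  exists2 s, s \in transversal_set & exists2 e, e < 4 & x = iter e f s.
Proof.
move=> x_neq1; have xr := mem_repr_quarter_orbit x.
have [a Aa [e xE]] := quarter_orbitP _ _ (quarter_orbit_sym xr).
exists (a (repr (quarter_orbit x))); last first.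
  by exists (e %% 4); rewrite ?ltn_pmod // iter_quarter_mod.
have sE: quarter_orbit (a (repr (quarter_orbit x))) = quarter_orbit x.
  rewrite (@quarter_orbit_eq (repr (quarter_orbit x))).
    exact: quarter_orbit_eq.
  by apply/quarter_orbitP; exists a => //; exists 0.
rewrite inE sE; apply/andP; split; last by apply/exists_inP; exists a.
by apply: contra x_neq1 => /eqP ar; rewrite xE ar iter_quarter1.
Qed.

Lemma transversal_inj s s' e e' :
    s \in transversal_set -> s' \in transversal_set -> e < 4 -> e' < 4 ->
  iter e f s = iter e' f s' -> e = e' /\ s = s'.
Proof.
move=> Ss Ss' e4 e'4 eqss'.
have /quarter_orbit_eq orb_eq: s' \in quarter_orbit s.
  apply/quarter_orbitP; exists 1 => //; exists (e' * 3 + e)%N.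
  rewrite perm1 iterD eqss' -iterD -mulnSr -iter_quarter_mod.
  by rewrite mulnC modnMr.
have s_neq1 := transversal_neq1 Ss.
move: (Ss) (Ss'); rewrite !inE orb_eq.
case/andP=> _ /exists_inP[a Aa /eqP sE] /andP[_ /exists_inP[b Ab /eqP s'E]].
suff ee': e = e'.
  by split=> //; move: eqss'; rewrite ee' => /iter_quarter_inj.
(* The permutation [a^-1 * b] takes s to s', and 3e + e' is e' - e modulo 4. *)
have: 4 %| e * 3 + e'.
  apply: (@quarter_orbit_free (a^-1 * b) _ s); rewrite ?groupM ?groupV //.
  rewrite {1}sE permM permK -s'E iterD -eqss' -iterD -mulnSr.
  by rewrite -iter_quarter_mod mulnC modnMr.
by move: e e' e4 e'4 {eqss'} => [|[|[|[|//]]]] [|[|[|[|//]]]].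
Qed.

(** * The family developed from the base blocks *)

Definition point (s : vT) (x : G1 * nat) : G1 * vT := (x.1, iter x.2 f s).

Definition block (s : vT) (b : seq (G1 * nat)) : {set G1 * vT} :=
  [set y in [seq point s x | x <- b]].

Definition quarter_family : seq {set G1 * vT} :=
  [seq block s b | s <- enum transversal_set, b <- base_blocks].

Lemma quarter_familyP B :
  reflect (exists s b, [/\ s \in transversal_set, b \in base_blocks & B = block s b])
          (B \in quarter_family).
Proof.
apply: (iffP allpairsPdep) => [] [s [b [Ss bb ->]]]; exists s, b;
  by rewrite ?mem_enum in Ss *.
Qed.

Lemma base_block_size b : b \in base_blocks -> size b = 3.
Proof. by move/(allP base_blocks_wf)=> /and3P[/eqP]. Qed.

Lemma base_block_lt4 b x : b \in base_blocks -> x \in b -> x.2 < 4.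
Proof. by move/(allP base_blocks_wf)=> /and3P[_ _ /allP]; apply. Qed.

Lemma point_eq s b : s \in transversal_set -> b \in base_blocks ->
  {in b &, forall x y, (point s x == point s y) = (x == y)}.
Proof.
move=> Ss bb x y bx b_y; apply/eqP/eqP => [|-> //].
have := base_block_lt4 bb bx; have := base_block_lt4 bb b_y.
case: x y {bx b_y} => [g e] [g' e'] /= e'4 e4 [-> eqf].
by have [-> _] := transversal_inj Ss Ss e4 e'4 eqf.
Qed.

Lemma uniq_points s b : s \in transversal_set -> b \in base_blocks ->
  uniq [seq point s x | x <- b].
Proof.
move=> Ss bb; rewrite map_inj_in_uniq.
  by have /and3P[_ /map_uniq] := allP base_blocks_wf _ bb.
by move=> x y bx b_y /eqP; rewrite (point_eq Ss bb) // => /eqP.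
Qed.

Lemma card_block s b : s \in transversal_set -> b \in base_blocks ->
  #|block s b| = 3.
Proof.
move=> Ss bb; rewrite cardE (perm_size (perm_enum_seq (uniq_points Ss bb))).
by rewrite size_map base_block_size.
Qed.

(** Transfers a symbolic table to the family, once for differences and once for cosets: [L] is the
    symbolic version of [D], and [q s] realises a symbol at the base point s. *)
Lemma perm_family (Y Z : eqType) (D : {set G1 * vT} -> seq Y)
    (L : seq (G1 * nat) -> seq Z) (q : vT -> Z -> Y) (Q : seq Z) :
    {in transversal_set & base_blocks, forall s b,
       perm_eq (D (block s b)) [seq q s z | z <- L b]} ->
    perm_eq (flatten [seq L b | b <- base_blocks]) Q ->
  perm_eq (flatten [seq D B | B <- quarter_family])
          [seq q s z | s <- enum transversal_set, z <- Q].
Proof.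
move=> DL LQ; rewrite flatten_map_allpairs; apply: perm_flatten_map => s.
rewrite mem_enum => Ss; apply: perm_trans (perm_map (q s) LQ).
by rewrite map_flatten -map_comp; apply: perm_flatten_map => b /(DL _ _ Ss).
Qed.

(** * The difference property *)

Lemma block_differences s b : s \in transversal_set -> b \in base_blocks ->
  perm_eq [seq z.1 * z.2^-1 | z <- enum (setX (block s b) (block s b)) & z.1 != z.2]
          [seq (w.1, iter w.2.2 f (iter w.2.1 one_minus s))
             | w <- base_differences b].
Proof.
move=> Ss bb.
have Us := uniq_points Ss bb.
have permP : perm_eq (enum (setX (block s b) (block s b)))
    [seq (u, v) | u <- [seq point s x | x <- b], v <- [seq point s x | x <- b]].
  apply: uniq_perm; first exact: enum_uniq.
    by apply: allpairs_uniq => // -[? ?] [? ?] _ _ [-> ->].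
  move=> [u v]; rewrite mem_enum !inE; apply/andP/allpairsP => /=.
    by case=> bu bv; exists (u, v).
  by case=> -[x y] /= [bx b_y [-> ->]].
apply: perm_trans (perm_map _ (perm_filter _ permP)) _.
rewrite {permP} allpairs_mapl allpairs_mapr.
rewrite -(map_allpairs (fun z => (point s z.1, point s z.2)) pair).
rewrite filter_map -!map_comp.
have bbP z : z \in [seq (x, y) | x <- b, y <- b] -> z.1 \in b /\ z.2 \in b.
  by case/allpairsP=> -[x y] /= [? ? ->].
rewrite (@eq_in_filter _ _ (fun z => z.1 != z.2)); last first.
  by move=> z /bbP[bz1 bz2] /=; rewrite (point_eq Ss bb).
have eq_perm (r r' : seq (G1 * vT)) : r = r' -> perm_eq r r' by move=> ->.
apply: eq_perm; rewrite /base_differences.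
apply/eq_in_map => z; rewrite mem_filter => /andP[z12 /bbP[bz1 bz2]] /=.
(* Entries with equal exponents would have the same index in the block. *)
have e12: z.1.2 != z.2.2.
  apply: contra z12 => /eqP e12; apply/eqP.
  have /and3P[_ U2 _] := allP base_blocks_wf _ bb.
  rewrite -[z.1](nth_index z.1 bz1) -[z.2](nth_index z.1 bz2).
  congr nth; apply/eqP; rewrite -(nth_uniq 0%N _ _ U2) ?size_map ?index_mem //.
  by rewrite !(nth_map z.1) ?index_mem // !nth_index // e12.
by congr (_, _); apply: quarter_diff; rewrite ?(base_block_lt4 bb).
Qed.

Let H : {group G1 * vT} := [group of setX [set: G1] [set 1 : vT]].

Lemma quarter_difference_family : difference_family H quarter_family.
Proof.
split=> [B /quarter_familyP[s [b [Ss bb ->]]]|]; first exact: card_block.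
apply: perm_trans (perm_family block_differences perm_base_differences) _.
apply: uniq_perm; rewrite ?enum_uniq //.
  apply: allpairs_uniq; [exact: enum_uniq | exact: difference_table_uniq |].
  move=> [u w] [u' w'] /allpairsP[[s [g [t e]]] [+ + [-> ->]]].
  move=> + + /allpairsP[[s' [g' [t' e']]] [+ + [-> ->]]].
  rewrite !mem_enum !mem_difference_table /=.
  move=> Ss /andP[/eqP-> e4] Ss' /andP[/eqP-> e'4] [<-].
  (* Both levels belong to the same g, so the power of 1 - i commutes past the turns and cancels. *)
  rewrite -!iter_one_minus_quarter => /iter_one_minus_inj eqf.
  by have [-> ->] := transversal_inj Ss Ss' e4 e'4 eqf.
move=> [g v]; rewrite mem_enum !inE; apply/allpairsP/idP.
  case=> -[s [g' [t e]]] []; rewrite mem_enum mem_difference_table /=.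
  move=> Ss /andP[/eqP-> e4] [_ ->].
  (* Zero is rewritten as its own image under each of the two injective maps; after cancelling, only
     s != 0 remains. *)
  rewrite -iter_one_minus_quarter -[X in _ == X](iter_one_minus1 (diff_level g')).
  rewrite (inj_eq (@iter_one_minus_inj _)) -[X in _ == X](iter_quarter1 e).
  by rewrite (inj_eq (@iter_quarter_inj _)) transversal_neq1.
move=> v_neq1.
(* The inverse [h] divides by the power of 1 - i at the level of g; the quotient is then written as
   i^e s. *)
have [h hK Kh] := injF_bij (@iter_one_minus_inj (diff_level g)).
have h_neq1 : h v != 1.
  by apply: contra v_neq1 => /eqP hv; rewrite -(Kh v) hv iter_one_minus1 /= eqxx.
have [s Ss [e e4 hE]] := transversal_exists h_neq1.
exists (s, (g, (diff_level g, e))); split; rewrite ?mem_enum //.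
  by rewrite mem_difference_table eqxx.
by rewrite /= -iter_one_minus_quarter -hE Kh.
Qed.

(** * Resolvability *)

Variable J : {group G1 * vT}.
Hypothesis JE : J :=: [set 1; (G1_involution, 1)].

Let JP g v g' v' :
  (g, v) \in (g', v') *: J -> v = v' /\ coset_rep g = coset_rep g'.
Proof.
rewrite JE => /lcosetP[x]; rewrite !inE => /orP[]/eqP-> [-> ->].
  by rewrite !mulg1.
by rewrite mulg1 coset_rep_invol.
Qed.

Lemma lcoset_coset_rep g v : (coset_rep g, v) *: J = (g, v) *: J.
Proof.
apply/lcoset_eqP/lcosetP; have /orP[/eqP->|/eqP->] := coset_repP g.
  by exists 1; rewrite ?mulg1.
exists (G1_involution, 1); first by rewrite JE !inE eqxx orbT.
by congr (_, _); rewrite mulg1.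
Qed.

Lemma quarter_resolvable : resolvable H J quarter_family.
Proof.
split.
- by rewrite JE; apply/subsetP => x; rewrite !inE => /orP[]/eqP->; rewrite eqxx.
- by rewrite JE cards2.
rewrite map_flatten -map_comp.
pose q s (z : G1 * nat) := (z.1, iter z.2 f s) *: J.
apply: perm_trans (perm_family (q := q) _ perm_base_points) _.
  move=> s b Ss bb.
  have := perm_map (fun x => x *: J) (perm_enum_seq (uniq_points Ss bb)).
  move/perm_trans; apply.
  rewrite -!map_comp; set t := map _ _; set t' := map _ _.
  suff -> : t = t' by exact: perm_refl.
  (* Replacing a point by its coset representative leaves the coset unchanged. *)
  by apply/eq_map => x; rewrite /= /q lcoset_coset_rep.
apply: uniq_perm; rewrite ?enum_uniq //.
  apply: allpairs_uniq; [exact: enum_uniq | exact: point_table_uniq |].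
  move=> [u w] [u' w'] /allpairsP[[s [g e]] [+ + [-> ->]]].
  move=> + + /allpairsP[[s' [g' e']] [+ + [-> ->]]].
  rewrite !mem_enum !mem_point_table /=.
  move=> Ss /andP[/eqP gE e4] Ss' /andP[/eqP g'E e'4] /lcoset_eqP/JP[eqf].
  rewrite gE g'E => ->.
  by have [-> ->] := transversal_inj Ss Ss' e4 e'4 eqf.
move=> C; rewrite mem_enum inE; apply/allpairsP/andP.
  case=> -[s [g e]] []; rewrite mem_enum mem_point_table => Ss /andP[_ e4] ->.
  split; first by apply/lcosetsP; exists (g, iter e f s).
  apply/subsetPn; exists (g, iter e f s); first exact: lcoset_refl.
  rewrite !inE /= -[X in _ == X](iter_quarter1 e).
  by rewrite (inj_eq (@iter_quarter_inj _)) transversal_neq1.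
case=> /lcosetsP[[g v] _ ->] notH.
(* The second coordinate is constant on a coset of [J], so v = 0 would put the whole coset inside
   [H]. *)
have v_neq1 : v != 1.
  apply: contra notH => /eqP->; apply/subsetP => -[g' v'] /JP[-> _].
  by rewrite !inE eqxx.
have [s Ss [e e4 vE]] := transversal_exists v_neq1.
exists (s, (coset_rep g, e)); rewrite mem_enum mem_point_table coset_rep_idem eqxx.
by rewrite /q lcoset_coset_rep -vE.
Qed.

(** * Strong multipliers *)

Lemma lift_snd_inj (a : {perm vT}) :
  injective (fun x : G1 * vT => (x.1, a x.2)).
Proof. by move=> [g v] [g' v'] [-> /perm_inj->]. Qed.

Definition lift_snd (a : {perm vT}) : {perm G1 * vT} := perm (@lift_snd_inj a).

Lemma lift_sndM : {in [set: {perm vT}] &, {morph lift_snd : a b / a * b}}.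
Proof. by move=> a b _ _; apply/permP => x; rewrite !(permE, permM). Qed.

Definition lift_snd_morphism := Morphism lift_sndM.

Lemma injm_lift_snd : 'injm lift_snd_morphism.
Proof.
apply/injmP => a b _ _ /permP eqab; apply/permP => v.
by have := eqab (1, v); rewrite /= !permE => -[].
Qed.

(** Commuting with the quarter turn, [a] only moves the base point s. *)
Lemma lift_snd_block a s b : a \in A -> lift_snd a @: block s b = block (a s) b.
Proof.
move=> Aa; apply/setP => y; rewrite inE; apply/imsetP/mapP.
  case=> x; rewrite inE => /mapP[z bz ->] ->; exists z => //.
  by rewrite permE /point /= A_iter.
case=> z bz ->; exists (point s z); first by rewrite inE map_f.
by rewrite permE /point /= A_iter.
Qed.

(** Blocks are permuted because the transversal is invariant under [a] and its inverse. *)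
Lemma lift_snd_strong_multiplier a :
  a \in A -> strong_multiplier H quarter_family (lift_snd a).
Proof.
move=> Aa; split.
- rewrite inE; apply/andP; split; first by apply/subsetP => x; rewrite !inE.
  apply/morphicP => x y _ _; rewrite !permE /=.
  by congr (_, _); rewrite AM.
- by move=> [g v]; rewrite !inE /= => /eqP->; rewrite permE /= A1.
apply/setP => B; rewrite inE; apply/imsetP/quarter_familyP.
  case=> _ /quarter_familyP[s [b [Ss bb ->]]] ->; exists (a s), b.
  by rewrite lift_snd_block // transversal_perm.
case=> s [b [Ss bb ->]]; exists (block (a^-1 s) b).
  by apply/quarter_familyP; exists (a^-1 s), b; rewrite transversal_perm ?groupV.
by rewrite lift_snd_block // permKV.
Qed.

Lemma quarter_family_exists : exists F : seq {set G1 * vT},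
  [/\ difference_family H F, resolvable H J F &
      exists2 M : {group {perm (G1 * vT)}},
        (forall a, a \in M -> strong_multiplier H F a) & #|M| = #|A|].
Proof.
exists quarter_family; split.
- exact: quarter_difference_family.
- exact: quarter_resolvable.
exists [group of lift_snd_morphism @* A] => [a /morphimP[b _ Ab ->]|].
  exact: lift_snd_strong_multiplier.
by rewrite card_injm ?subsetT // injm_lift_snd.
Qed.

End QuarterTurn.

(* Square roots of -1 in finite fields *)
Local Close Scope group_scope.

(** The cyclic unit group has order divisible by 4, and an element c of order 4 satisfies (c^2 -
    1)(c^2 + 1) = 0 with c^2 != 1. *)
Lemma sqrtN1_exists (F : finFieldType) : #|F| = 1 %[mod 4] ->
  exists2 c : F, (c * c = -1)%R & (1 + 1 != 0 :> F)%R.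
Proof.
move=> F4.
have F_gt0 : 0 < #|F| by apply/card_gt0P; exists 0%R.
have dvd4 : 4 %| #|[set: {unit F}]|.
  by rewrite card_finField_unit -subn1 -eqn_mod_dvd // F4.
have /cyclicP[x xE] := field_unit_group_cyclic [group of [set: {unit F}]].
rewrite /= in xE.
have ox : #[x]%g = #|[set: {unit F}]| by rewrite xE.
pose y := (x ^+ (#[x] %/ 4))%g.
have oy : #[y]%g = 4.
  by rewrite orderXdiv ?divnA ?ox ?dvdn_div // ?mulKn // dvdn_div.
pose c : F := FinRing.uval y.
have cX k : (c ^+ k = FinRing.uval (y ^+ k)%g)%R by rewrite FinRing.val_unitX.
have c4 : (c ^+ 4 = 1)%R by rewrite cX -oy expg_order.
have c2 : (c ^+ 2 != 1)%R.
  rewrite cX -(FinRing.val_unit1 F) (inj_eq val_inj) -order_dvdn oy.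
  by [].
have cN : (c * c = -1)%R.
  apply/eqP; rewrite -addr_eq0.
  have: ((c ^+ 2 - 1) * (c ^+ 2 + 1) == 0)%R.
    by rewrite -subr_sqr -exprM c4 expr1n subrr.
  by rewrite mulf_eq0 subr_eq0 (negPf c2) /= expr2.
exists c => //.
(* If 1 + 1 = 0, then c^2 = -1 = 1, against the order of c. *)
apply: contra c2 => /eqP two0; rewrite expr2 cN.
by rewrite eq_sym -addr_eq0 two0.
Qed.

(** * The product of fields and its unit group *)

Section ComponentProduct.

Variable n : nat.
Local Notation I := 'I_(size (components n)).
Local Notation K i := (component_field (N := n) i).

Lemma V_mulE (x y : V n) i : (x * y)%g i = (x i + y i : K i)%R.
Proof. by rewrite ffunE. Qed.

Lemma V_oneE i : (1%g : V n) i = (0 : K i)%R.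
Proof. by rewrite ffunE. Qed.

Lemma V_invE (x : V n) i : (x^-1)%g i = (- x i : K i)%R.
Proof. by rewrite ffunE. Qed.

Definition V_scale (c : forall i : I, K i) (x : V n) : V n :=
  [ffun i => (c i * x i : K i)%R].

Lemma V_scaleE c x i : V_scale c x i = (c i * x i : K i)%R.
Proof. by rewrite ffunE. Qed.

Lemma V_scaleM c : {morph V_scale c : x y / (x * y)%g}.
Proof. by move=> x y; apply/ffunP => i; rewrite !(V_scaleE, V_mulE) mulrDr. Qed.

Definition V_unit : finGroupType := {dffun forall i : I, {unit K i}}.

Definition unit_scale (u : V_unit) : V n -> V n :=
  V_scale (fun i => FinRing.uval (u i)).

Lemma unit_scale_inj u : injective (unit_scale u).
Proof.
move=> x y /ffunP eqxy; apply/ffunP => i; have := eqxy i.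
by rewrite !V_scaleE; apply: mulrI; apply: (valP (u i)).
Qed.

Definition unit_perm (u : V_unit) : {perm V n} := perm (@unit_scale_inj u).

Lemma unit_permE u x i : unit_perm u x i = (FinRing.uval (u i) * x i : K i)%R.
Proof. by rewrite permE V_scaleE. Qed.

Lemma unit_permM : {in [set: V_unit] &, {morph unit_perm : u w / (u * w)%g}}.
Proof.
move=> u w _ _; apply/permP => x; apply/ffunP => i.
by rewrite permM !unit_permE ffunE FinRing.val_unitM mulrA
  (mulrC (FinRing.uval (w i))).
Qed.

Definition unit_perm_morphism := Morphism unit_permM.

Lemma injm_unit_perm : ('injm unit_perm_morphism)%g.
Proof.
apply/injmP => u w _ _ /permP equw; apply/ffunP => i; apply: val_inj.
(* The vector with all entries 1 recovers a unit from its action. *)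
have /ffunP/(_ i) := equw [ffun=> (1 : K _)%R].
by rewrite !unit_permE !ffunE !mulr1.
Qed.

Lemma card_V_unit : #|[set: V_unit]| = psi n.
Proof.
rewrite cardsT card_dep_ffun /psi (big_nth 0) big_mkord foldrE big_map.
rewrite big_enum; apply: eq_bigr => i _.
by rewrite -cardsT card_finField_unit (svalP (component_field_exists i)).
Qed.

Lemma abelian_V_unit : abelian [set: V_unit].
Proof.
apply/centsP => u _ w _; apply/ffunP => i; rewrite !ffunE; apply: val_inj.
by rewrite /= mulrC.
Qed.

End ComponentProduct.

(** * Application to the additive group [V n] *)

Theorem theorem7p5 (n : nat) (n_gt0 : 0 < n)
    (comp_n : forall q : nat, q \in components n -> q = 1 %[mod 4]) :
  exists F : seq {set G1 * V n},
    [/\ difference_family (G1_sub n) F,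
        resolvable (G1_sub n) (canonical_J n) F &
        exists2 A : {group {perm (G1 * V n)}},
          (forall a, a \in A -> strong_multiplier (G1_sub n) F a) &
          #|A| = greatest_odd_divisor (psi n)].
Proof.
have sqrtN1 i : exists c : component_field (N := n) i,
    ((c * c == -1) && (1 + 1 != 0 :> component_field (N := n) i))%R.
  have [|c cc two] := @sqrtN1_exists (component_field (N := n) i).
    by rewrite (svalP (component_field_exists i)); apply/comp_n/mem_nth.
  by exists c; rewrite cc eqxx.
pose c i := xchoose (sqrtN1 i).
have cP i := xchooseP (sqrtN1 i).
have psi_gt0 : 0 < psi n by rewrite -card_V_unit cardG_gt0.
(* In the abelian unit group the 2'-core is a Hall subgroup, so its order is the odd part of
   [psi n]; the faithful action on [V n] preserves this order. *)
pose A := [group of unit_perm_morphism n @* 'O_2^'([set: V_unit n])]%g.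
have cardA : #|A| = greatest_odd_divisor (psi n).
  rewrite greatest_odd_divisorE // card_injm ?subsetT ?injm_unit_perm //.
  have nilU := abelian_nil (abelian_V_unit n).
  by rewrite (card_Hall (nilpotent_pcore_Hall 2^' nilU)) card_V_unit.
have AP a : a \in A -> exists u, a = unit_perm u.
  by case/morphimP=> u _ _ ->; exists u.
rewrite -cardA; apply: (@quarter_family_exists _ (V_scale c)).
- by move=> x y; apply/ffunP => i; rewrite !V_mulE addrC.
- exact: V_scaleM.
- move=> x; apply/ffunP => i; rewrite !V_scaleE V_invE mulrA.
  by have /andP[/eqP-> _] := cP i; rewrite mulN1r.
(* Absence of 2-torsion: 1 + 1 is nonzero in every component. *)
- move=> x /ffunP xx; apply/ffunP => i; have := xx i.
  rewrite V_mulE V_oneE => /eqP; have /andP[_ two] := cP i.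
  by rewrite -[x i]mul1r -mulrDl mulf_eq0 (negPf two) /= mul1r => /eqP.
- by rewrite cardA greatest_odd_divisorE // odd_2'nat part_pnat.
- move=> a /AP[u ->] x y; apply/ffunP => i.
  by rewrite !(unit_permE, V_mulE) mulrDr.
- move=> a /AP[u ->] x; apply/ffunP => i.
  by rewrite !(unit_permE, V_scaleE) mulrCA.
rewrite /= /canonical_involution.
by have <- : G1_involution = (0, 1, 1)%R by apply/eqP.
Qed.
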